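(* Consider the DD-phys strategy on $k\ge1$ physical qubits, i.e. the trivial code with $n=k$, $\mathcal S=\{I\}$, with decoupling group a nontrivial subgroup $\tilde G\subset\tilde{\mathcal P}_k$, physical error probability $p\in[0,1)$, $z=p/(3-3p)$, and suppression parameter $p_{\rm DD}\in[0,1]$. Then the fidelity can be written as $$F_{\rm DD}=\frac{W(\pi(\mathcal S)\cap\tilde G^\perp;z)+p_{\rm DD}\,W(\pi(\mathcal S)\setminus\tilde G^\perp;z)}{W(\tilde G^\perp;z)+p_{\rm DD}\,W(\tilde{\mathcal P}_k\setminus\tilde G^\perp;z)},$$ and for $\tilde G=\tilde{\mathcal P}_k$ (so that $\tilde G^\perp=\{\pi(I)\}$) this reduces to $$F_{\rm DD}=\frac{(1-p)^k}{(1-p)^k+p_{\rm DD}\bigl[1-(1-p)^k\bigr]}.$$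
   Context: $\mathcal P_k$ is the $k$-qubit Pauli group, $\tilde{\mathcal P}_k$ its quotient by phases, $\pi:\mathcal P_k\to\tilde{\mathcal P}_k$ the projection. Elements of $\tilde{\mathcal P}_k$ are strings in $\{I,X,Y,Z\}^k$, with weight $\mathrm{wt}(E')$ the number of non-identity letters. Two elements of $\tilde{\mathcal P}_k$ commute (anticommute) if their representatives in $\mathcal P_k$ do. $\tilde G^\perp$ is the set of $E'\in\tilde{\mathcal P}_k$ commuting with every element of $\tilde G$. For $A\subset\tilde{\mathcal P}_k$, $W(A;z)=\sum_{E'\in A}z^{\mathrm{wt}(E')}$. Error model: a random $E'\in\tilde{\mathcal P}_k$ is drawn from the distribution obtained from $(1-p)^{k-\mathrm{wt}(E')}(p/3)^{\mathrm{wt}(E')}$ by multiplying the probabilities of all $E'\notin\tilde G^\perp$ by $p_{\rm DD}$ and renormalizing. $F_{\rm DD}$ is the probability of no logical error, i.e. that $E'\in\pi(\mathcal S)$ (no recovery is applied). *)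

(* Defs.v *)
From HB Require Import structures.
From mathcomp Require Import all_boot all_order all_fingroup all_algebra.

Set Implicit Arguments.
Unset Strict Implicit.
Unset Printing Implicit Defensive.

Import GRing.Theory Num.Theory.
Local Open Scope ring_scope.

Variant letter := PI | PX | PY | PZ.

Definition letter_code (a : letter) : bool * bool :=
  match a with
  | PI => (false, false)
  | PX => (true, false)
  | PY => (true, true)
  | PZ => (false, true)
  end.

Definition letter_decode (u : bool * bool) : letter :=
  match u with
  | (false, false) => PI
  | (true, false) => PX
  | (true, true) => PY
  | (false, true) => PZ
  end.

Lemma letter_codeK : cancel letter_code letter_decode.
Proof. by case. Qed.

HB.instance Definition _ := Finite.copy letter (can_type letter_codeK).

(* The single-qubit table: sigma_a sigma_b = i^e sigma_c for
   (e, c) = letter_table a b. *)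
Definition letter_table (a b : letter) : 'Z_4 * letter :=
  match a, b with
  | PI, c | c, PI => (0, c)
  | PX, PX | PY, PY | PZ, PZ => (0, PI)
  | PX, PY => (1, PZ) | PY, PX => (-1, PZ)
  | PY, PZ => (1, PX) | PZ, PY => (-1, PX)
  | PZ, PX => (1, PY) | PX, PZ => (-1, PY)
  end.

Definition letter_mul (a b : letter) : letter := (letter_table a b).2.
Definition letter_phase (a b : letter) : 'Z_4 := (letter_table a b).1.

Lemma letter_mulA : associative letter_mul.
Proof. by do 3!case. Qed.

Lemma letter_mul1 : left_id PI letter_mul.
Proof. by case. Qed.

Lemma letter_mulV : left_inverse PI id letter_mul.
Proof. by case. Qed.

HB.instance Definition _ :=
  Finite_isGroup.Build letter letter_mulA letter_mul1 letter_mulV.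

(* The quotient of the k-qubit Pauli group by phases: strings of letters under
   letterwise multiplication. *)
Definition pauliq (k : nat) := {dffun forall _ : 'I_k, letter}.

HB.instance Definition _ k := FinGroup.on (pauliq k).

Lemma pauliqM k (s t : pauliq k) j : (s * t)%g j = letter_mul (s j) (t j).
Proof. exact: (dffunM j). Qed.

Lemma pauliq1 k j : (1%g : pauliq k) j = PI.
Proof. by rewrite ffunE. Qed.

(* Pauli c s stands for i^c times the tensor product of the Pauli matrices
   named by s; see pauli_op below. *)
Record pauli (k : nat) := Pauli { phase : 'Z_4; string : pauliq k }.
Arguments Pauli {k}.

Definition pauli_pair k (g : pauli k) := (phase g, string g).
Definition pair_pauli k (u : 'Z_4 * pauliq k) := Pauli u.1 u.2.

Lemma pauli_pairK k : cancel (@pauli_pair k) (@pair_pauli k).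
Proof. by case. Qed.

HB.instance Definition _ k := Finite.copy (pauli k) (can_type (@pauli_pairK k)).

Definition string_phase k (s t : pauliq k) : 'Z_4 :=
  \sum_(j < k) letter_phase (s j) (t j).

Definition pauli_mul k (g h : pauli k) : pauli k :=
  Pauli (phase g + phase h + string_phase (string g) (string h))
        (string g * string h)%g.

Definition pauli_one k : pauli k := Pauli 0 1%g.

Definition pauli_inv k (g : pauli k) : pauli k := Pauli (- phase g) (string g).

Lemma letter_phaseA a b c :
  letter_phase b c + letter_phase a (letter_mul b c) =
  letter_phase a b + letter_phase (letter_mul a b) c.
Proof. by case: a b c => -[] []; apply/val_inj. Qed.

Lemma pauli_mulA k : associative (@pauli_mul k).
Proof.
move=> [c s] [d t] [e u]; rewrite /pauli_mul /= mulgA; congr Pauli.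
have E : string_phase t u + string_phase s (t * u)%g =
         string_phase s t + string_phase (s * t)%g u.
  rewrite /string_phase -!big_split; apply: eq_bigr => j _ /=.
  by rewrite !pauliqM letter_phaseA.
rewrite -!addrA; congr (_ + (_ + _)).
by rewrite E !addrA; congr (_ + _); rewrite addrC.
Qed.

Lemma pauli_mul1 k : left_id (pauli_one k) (@pauli_mul k).
Proof.
move=> [c s]; rewrite /pauli_mul /= mul1g add0r; congr Pauli.
by rewrite /string_phase big1 ?addr0 // => j _; rewrite pauliq1; case: (s j).
Qed.

Lemma pauli_mulV k : left_inverse (pauli_one k) (@pauli_inv k) (@pauli_mul k).
Proof.
move=> [c s]; rewrite /pauli_mul /pauli_inv /= addNr add0r; congr Pauli.
  by rewrite /string_phase big1 // => j _; case: (s j).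
by apply/ffunP => j; rewrite pauliqM pauliq1; case: (s j).
Qed.

HB.instance Definition _ k := Finite_isGroup.Build (pauli k)
  (@pauli_mulA k) (@pauli_mul1 k) (@pauli_mulV k).

(* The faithful representation of pauli k by matrices acting on k qubits, with
   basis vectors labelled by k-bit words. *)
Section Representation.

Variable C : numClosedFieldType.

Definition sigma (a : letter) (x y : bool) : C :=
  match a with
  | PI => (x == y)%:R
  | PX => (x != y)%:R
  | PY => if x == y then 0 else if x then 'i else - 'i
  | PZ => if x != y then 0 else (-1) ^+ x
  end.

Definition word k (x : 'I_#|{ffun 'I_k -> bool}|) : {ffun 'I_k -> bool} :=
  enum_val x.

Definition pauli_op k (g : pauli k) : 'M[C]_(#|{ffun 'I_k -> bool}|) :=
  \matrix_(x, y) ('i ^+ phase g *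
    \prod_(j < k) sigma (string g j) (word x j) (word y j)).

Lemma imX4 : ('i : C) ^+ 4 = 1.
Proof. by rewrite (exprM _ 2 2) sqrCi sqrrN expr1n. Qed.

Lemma imXD (c d : 'Z_4) : ('i : C) ^+ (c + d)%R = 'i ^+ c * 'i ^+ d.
Proof. by rewrite -exprD /= expr_mod // imX4. Qed.

Lemma sigmaM a b x z :
  \sum_y sigma a x y * sigma b y z =
  'i ^+ letter_phase a b * sigma (letter_mul a b) x z.
Proof.
have i2 : ('i : C) * 'i = -1 by rewrite -expr2 sqrCi.
have i3 : ('i : C) ^+ 3 = - 'i by rewrite exprS sqrCi mulrN1.
rewrite big_bool; case: a b x z => -[] [] [] /=;
  rewrite ?(mulr0, mul0r, mulr1, mul1r, addr0, add0r, expr0, expr1, i3,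
    mulrN, mulNr, i2, opprK, oppr0) //.
Qed.

Lemma pauli_opM k (g h : pauli k) :
  pauli_op (g * h)%g = pauli_op g *m pauli_op h.
Proof.
apply/matrixP => x z; rewrite !mxE.
under [X in _ = X]eq_bigr => y _ do rewrite !mxE mulrACA -big_split /=.
rewrite -mulr_sumr.
rewrite -(big_enum_val (fun f : {ffun 'I_k -> bool} =>
  \prod_(j < k) (sigma (string g j) (word x j) (f j) *
                 sigma (string h j) (f j) (word z j)))) /=.
rewrite -(bigA_distr_bigA (fun j b => sigma (string g j) (word x j) b *
                 sigma (string h j) b (word z j))) /=.
under [in RHS]eq_bigr => j _ do rewrite sigmaM -pauliqM.
rewrite big_split (expr_mod _ imX4) exprD (expr_mod _ imX4) exprD -mulrA.
rewrite -!mulrA; congr (_ * (_ * (_ * _))).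
rewrite /string_phase; elim/big_rec2: _ => [|j c d _ <-]; first exact: expr0.
exact: imXD.
Qed.

Lemma pauli_op1 k : pauli_op (1%g : pauli k) = 1%:M.
Proof.
apply/matrixP => x y; rewrite !mxE expr0 mul1r.
under eq_bigr => j _ do rewrite pauliq1 /=.
have [->|neq_xy] := eqVneq x y; first by rewrite big1 // => j _; rewrite eqxx.
have [j nj] : exists j, word x j != word y j.
  apply/existsP; apply: contraNT neq_xy; rewrite negb_exists => /forallP e.
  by apply/eqP/enum_val_inj/ffunP => j; apply/eqP; rewrite -[_ == _]negbK.
by rewrite (bigD1 j) //= (negPf nj) mul0r.
Qed.

Lemma pauli_op_inj k : injective (@pauli_op k).
Proof.
suff ker g : pauli_op g = 1%:M -> g = 1%g :> pauli k.
  move=> g h eq_gh; apply/eqP; rewrite eq_mulgV1; apply/eqP/ker.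
  by rewrite pauli_opM eq_gh -pauli_opM mulgV pauli_op1.
case: g => c s E.
have D (f : {ffun 'I_k -> bool}) :
    'i ^+ c * \prod_(j < k) sigma (s j) (f j) (f j) = 1.
  by move/matrixP: E => /(_ (enum_rank f) (enum_rank f)); rewrite !mxE eqxx /word enum_rankK.
pose f0 : {ffun 'I_k -> bool} := [ffun=> false].
have s1 : s = 1%g.
  apply/ffunP => j; rewrite pauliq1.
  pose f1 : {ffun 'I_k -> bool} := [ffun l => l == j].
  move: (D f0) (D f1); rewrite (bigD1 j) //= [in X in _ -> X](bigD1 j) //=.
  rewrite !ffunE eqxx.
  have -> : \prod_(l < k | l != j) sigma (s l) (f1 l) (f1 l) =
            \prod_(l < k | l != j) sigma (s l) (f0 l) (f0 l).
    by apply: eq_bigr => l /negPf nl; rewrite !ffunE nl.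
  case: (s j) => //= ; rewrite ?(mul0r, mulr0, mul1r) => e1.
  - by move/esym/eqP; rewrite oner_eq0.
  - by move/esym/eqP; rewrite oner_eq0.
  - rewrite expr1 mulN1r mulrN e1 => /eqP.
    by rewrite eq_sym -subr_eq0 opprK -(natrD _ 1 1) pnatr_eq0.
have := D f0; rewrite s1 big1 => [|j _]; last by rewrite pauliq1 /= eqxx.
rewrite mulr1 => ic; congr Pauli; apply/val_inj => /=.
case: c ic {E D} => -[|[|[|[|m]]]] //= _.
- by move=> e; have := sqrCi C; rewrite -['i]expr1 e expr1n => /eqP;
    rewrite -subr_eq0 opprK -(natrD _ 1 1) pnatr_eq0.
- by rewrite sqrCi => /eqP; rewrite eq_sym -subr_eq0 opprK -(natrD _ 1 1) pnatr_eq0.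
- rewrite exprS sqrCi mulrN1 => e; have := sqrCi C.
  by rewrite -sqrrN e expr1n => /eqP; rewrite -subr_eq0 opprK -(natrD _ 1 1) pnatr_eq0.
Qed.

End Representation.

Section Projection.

Variable k : nat.

Definition proj (g : pauli k) : pauliq k := string g.

Lemma projM : {morph proj : g h / (g * h)%g}.
Proof. by []. Qed.

(* pauliq k is the quotient by the phases Pauli c 1. *)
Lemma proj_eqP (g h : pauli k) :
  proj g = proj h <-> exists c : 'Z_4, g = (Pauli c 1 * h)%g.
Proof.
split=> [e|[c ->]]; last by rewrite projM /proj mul1g.
exists (phase g - phase h); case: g h e => [c s] [d t] /= e.
have {e} -> : s = t by [].
congr Pauli; last by rewrite mul1g.
rewrite subrK /string_phase big1 ?addr0 // => j _.
by rewrite pauliq1; case: (t j).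
Qed.

Definition commutes (E F : pauliq k) : bool :=
  [forall g : pauli k, forall h : pauli k,
     (proj g == E) && (proj h == F) ==> (g * h == h * g)%g].

Definition perp (G : {set pauliq k}) : {set pauliq k} :=
  [set E | [forall F in G, commutes E F]].

Definition wt (E : pauliq k) : nat := #|[set j | E j != PI]|.

End Projection.

Section ErrorModel.

Variables (R : realFieldType) (k : nat).

Definition W (A : {set pauliq k}) (z : R) : R := \sum_(E in A) z ^+ wt E.

Definition bare_prob (p : R) (E : pauliq k) : R :=
  (1 - p) ^+ (k - wt E) * (p / 3) ^+ wt E.

Definition suppressed_prob (G : {set pauliq k}) (p pDD : R) (E : pauliq k) : R :=
  if E \in perp G then bare_prob p E else pDD * bare_prob p E.

Definition error_prob (G : {set pauliq k}) (p pDD : R) (E : pauliq k) : R :=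
  suppressed_prob G p pDD E / \sum_F suppressed_prob G p pDD F.

Definition F_DD (S : {set pauli k}) (G : {set pauliq k}) (p pDD : R) : R :=
  \sum_(E in @proj k @: S) error_prob G p pDD E.

End ErrorModel.

(* Main.v *)
(* Since z = (p/3) / (1 - p), an error E has bare probability
   (1 - p)^k z^(wt E), and the common factor (1 - p)^k cancels in F_DD.  The
   bare probabilities are products over the qubits, so they sum to 1; and a
   string with a non-identity letter anticommutes with some string supported
   on that single position, so only 1 commutes with all strings. *)
Require Import Defs.
From mathcomp Require Import all_boot all_order all_fingroup all_algebra.
From mathcomp Require Import ring lra.
Import GRing.Theory Num.Theory.
Local Open Scope ring_scope.

Lemma sum_letter (V : nmodType) (f : letter -> V) :
  \sum_a f a = f PI + f PX + f PY + f PZ.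
Proof.
rewrite (bigD1 PI) // (bigD1 PX) // (bigD1 PY) // (bigD1 PZ) //= big1 => [|[]//].
by rewrite addr0 !addrA.
Qed.

Lemma wt_le k (E : pauliq k) : (wt E <= k)%N.
Proof. by rewrite -[leqRHS]card_ord max_card. Qed.

Lemma wt1 k : wt (1%g : pauliq k) = 0%N.
Proof.
by apply: eq_card0 => j; rewrite inE pauliq1 eqxx.
Qed.

(** Qubits err independently under the bare distribution; in this form its total mass factors over
    positions. *)
Lemma bare_prob_prod (R : realFieldType) k (p : R) (E : pauliq k) :
  bare_prob p E = \prod_(j < k) (if E j == PI then 1 - p else p / 3).
Proof.
rewrite big_if /= !prodr_const /bare_prob; congr (_ ^+ _ * _ ^+ _).
  rewrite -{1}[k]card_ord -(cardsC [set j | E j != PI]) addKn; apply: eq_card => j.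
  by rewrite !inE negbK.
by apply: eq_card => j; rewrite !inE.
Qed.

Lemma sum_bare_prob (R : realFieldType) k (p : R) :
  \sum_(E : pauliq k) bare_prob p E = 1.
Proof.
under eq_bigr do rewrite bare_prob_prod.
(* Distributivity turns the sum over strings into a product over qubits of sums over letters, each
   equal to [(1 - p) + 3 * (p / 3) = 1]. *)
rewrite -(bigA_distr_bigA (fun (j : 'I_k) a => if a == PI then 1 - p else p / 3)).
by rewrite big1 // => j _; rewrite sum_letter /=; field.
Qed.

Lemma bare_prob_wt (R : realFieldType) k (p : R) (E : pauliq k) : p != 1 ->
  bare_prob p E = (1 - p) ^+ k * (p / (3 - 3 * p)) ^+ wt E.
Proof.
move=> p1; have q0 : 1 - p != 0 by rewrite subr_eq0 eq_sym.
(* Moving [wt E] factors [1 - p] next to those of [p / 3] reduces the claim to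
   [p / 3 = (1 - p) * (p / (3 - 3 * p))]; [wt_le] keeps the natural subtraction from truncating. *)
have -> : (1 - p) ^+ k = (1 - p) ^+ (k - wt E + wt E) by rewrite subnK ?wt_le.
rewrite /bare_prob exprD -mulrA -exprMn.
congr (_ * _ ^+ _); field.
by apply: contraNneq q0 => e; apply/eqP; lra.
Qed.

Lemma sum_bare_prob_W (R : realFieldType) k (p : R) (A : {set pauliq k}) :
  p != 1 -> \sum_(E in A) bare_prob p E = (1 - p) ^+ k * W A (p / (3 - 3 * p)).
Proof.
by move=> p1; rewrite mulr_sumr; apply: eq_bigr => E _; apply: bare_prob_wt.
Qed.

(** The set [A] is arbitrary so that both the numerator of [F_DD] and, with [A = setT], its
    normalizing sum are covered. *)
Lemma sum_suppressed_prob (R : realFieldType) k (A G : {set pauliq k})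
    (p pDD : R) :
  \sum_(E in A) suppressed_prob G p pDD E =
  \sum_(E in A :&: perp G) bare_prob p E
  + pDD * \sum_(E in A :\: perp G) bare_prob p E.
Proof.
rewrite (big_setID (perp G)) mulr_sumr; congr (_ + _); apply: eq_bigr => E.
  by rewrite inE /suppressed_prob => /andP[_ ->].
by rewrite inE /suppressed_prob => /andP[/negPf -> _].
Qed.

Lemma F_DD_sum (R : realFieldType) k (S : {set pauli k}) (G : {set pauliq k})
    (p pDD : R) :
  let piS := [set proj g | g in S] in
  F_DD S G p pDD =
    (\sum_(E in piS :&: perp G) bare_prob p E
     + pDD * \sum_(E in piS :\: perp G) bare_prob p E)
    / (\sum_(E in perp G) bare_prob p E
       + pDD * \sum_(E in ~: perp G) bare_prob p E).
Proof.
move=> piS; rewrite /F_DD -mulr_suml sum_suppressed_prob; congr (_ / _).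
have := sum_suppressed_prob R k setT G p pDD; rewrite setTI setTD => <-.
by apply: eq_bigl => E; rewrite inE.
Qed.

Lemma phaseM k (g h : pauli k) :
  phase (g * h)%g = phase g + phase h + string_phase (string g) (string h).
Proof. by []. Qed.

(** Scalar phases add commutatively and strings multiply commutatively, so the two orders of a
    product can differ only in [string_phase], whatever the representatives. *)
Lemma commutesE k (E F : pauliq k) :
  commutes E F = (string_phase E F == string_phase F E).
Proof.
apply/idP/eqP => [/forallP/(_ (Pauli 0 E))/forallP/(_ (Pauli 0 F))|eEF].
  rewrite /proj !eqxx => /eqP/(congr1 (@phase k)).
  by rewrite !phaseM !add0r.
apply/forallP => -[c s]; apply/forallP => -[d t]; apply/implyP.
rewrite /proj /= => /andP[/eqP-> /eqP->]; apply/eqP; congr Pauli.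
  by rewrite /= eEF; congr (_ + _); rewrite addrC.
by apply/ffunP => j; rewrite /= !pauliqM; case: (E j) (F j) => -[].
Qed.

Lemma perpT k : perp [set: pauliq k] = [set 1%g].
Proof.
apply/setP => E; rewrite !inE; apply/'forall_implyP/eqP => [cE|-> F _]; last first.
  rewrite commutesE; apply/eqP/eq_bigr => j _; rewrite pauliq1.
  by case: (F j).
apply/ffunP => j; rewrite pauliq1.
pose single b : pauliq k := [ffun i => if i == j then b else PI].
(* Away from [j] the string [single b] has letter [PI], which contributes phase 0, so only position
   [j] matters. *)
have {}cE b : letter_phase (E j) b = letter_phase b (E j).
  have := cE (single b) (in_setT _); rewrite commutesE => /eqP.
  rewrite /string_phase (bigD1 j) //= [RHS](bigD1 j) //= !ffunE eqxx.
  by rewrite !big1 ?addr0 // => i /negPf ij; rewrite ffunE ij; case: (E i).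
(* Testing against [PX] excludes [PY] and [PZ]; testing against [PY] excludes [PX]. *)
by move: (cE PX) (cE PY); case: (E j).
Qed.

Theorem lemma2 (R : realFieldType) (k : nat) (k_ge1 : (1 <= k)%N)
    (S : {group pauli k}) (trivS : S = [set 1%g] :> {set pauli k})
    (p : R) (p_ge0 : 0 <= p) (p_lt1 : p < 1)
    (pDD : R) (pDD_ge0 : 0 <= pDD) (pDD_le1 : pDD <= 1) :
  let z := p / (3 - 3 * p) in
  let piS := [set proj g | g in S] in
  (forall G : {group pauliq k}, G != [set 1%g] :> {set pauliq k} ->
     F_DD S G p pDD =
       (W (piS :&: perp G) z + pDD * W (piS :\: perp G) z)
       / (W (perp G) z + pDD * W (~: perp G) z)) /\
  perp [set: pauliq k] = [set proj 1%g] /\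
  F_DD S [set: pauliq k] p pDD =
    (1 - p) ^+ k / ((1 - p) ^+ k + pDD * (1 - (1 - p) ^+ k)).
Proof.
move=> z piS.
have p1 : p != 1 by rewrite Order.POrderTheory.lt_eqF.
have qk0 : (1 - p) ^+ k != 0 by rewrite expf_neq0 // subr_eq0 eq_sym.
split=> [G _|]; last split.
- rewrite F_DD_sum !sum_bare_prob_W // !(mulrCA pDD) -!mulrDr.
  by rewrite invfM mulrACA divff // mul1r.
- exact: perpT.
- have bare1 : bare_prob p (1%g : pauliq k) = (1 - p) ^+ k.
    by rewrite /bare_prob wt1 subn0 mulr1.
  rewrite F_DD_sum perpT trivS imset_set1 setIid setDv big_set0 mulr0 addr0.
  rewrite !big_set1 bare1; congr (_ / (_ + pDD * _)).
  (* The mass outside [perp G], now the singleton of the identity, is the total 1 minus the term of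
     the identity. *)
  have := sum_bare_prob R k p; rewrite (bigD1 1%g) //= bare1.
  move/(canRL (addKr _)); rewrite [RHS]addrC => <-.
  by apply: eq_bigl => E; rewrite !inE.
Qed.
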